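(* Let $g:\mathbb{R}^m\to\mathbb{R}$ be a (not necessarily convex) Fréchet differentiable function whose gradient is $L_g$-Lipschitz continuous ($L_g\ge 0$), and assume $g$ is bounded from below. Let $\alpha>0$, $\beta\in(0,1)$, $0<s<\frac{2(1-\beta)}{L_g}$, and let $(x_n)_{n\in\mathbb{N}}$, $(y_n)_{n\in\mathbb{N}}$ be the sequences generated from a starting point $x_0=y_0\in\mathbb{R}^m$ by $$x_{n+1}=y_n-s\nabla g(y_n)\ (n\ge 0),\qquad y_n=x_n+\frac{\beta n}{n+\alpha}(x_n-x_{n-1})\ (n\ge 1).$$ Assume that $(x_n)_{n\in\mathbb{N}}$ is bounded, let $\overline{x}\in\operatorname{crit}(g)$ be such that $\lim_{n\to+\infty}x_n=\overline{x}$, and suppose that $$H:\mathbb{R}^m\times\mathbb{R}^m\to\mathbb{R},\quad H(x,y)=g(x)+\frac12\|x-y\|^2$$ fulfills the Łojasiewicz property at $(\overline{x},\overline{x})\in\operatorname{crit} H$ with Łojasiewicz exponent $\theta\in\left(0,\frac12\right]$. Then, for every $p>0$ there exist $a_1,a_2,a_3,a_4>0$ and $\overline{k}\in\mathbb{N}$ such that: (a$_1$) $g(y_n)-g(\overline{x})\le a_1\frac{1}{n^p}$ for every $n>\overline{k}$; (a$_2$) $g(x_n)-g(\overline{x})\le a_2\frac{1}{n^p}$ for every $n>\overline{k}$; (a$_3$) $\|x_n-\overline{x}\|\le a_3\frac{1}{n^{p/2}}$ for every $n>\overline{k}$; (a$_4$) $\|y_n-\overline{x}\|\le a_4\frac{1}{n^{p/2}}$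 for every $n>\overline{k}$.
   Context: $\|\cdot\|$ is the Euclidean norm; $\mathbb{N}=\{0,1,2,\dots\}$; $\operatorname{crit} f=\{x:\nabla f(x)=0\}$ for a differentiable function $f$. ''$L_g$-Lipschitz continuous gradient'' means $\|\nabla g(x)-\nabla g(y)\|\le L_g\|x-y\|$ for all $x,y$. The condition $0<s<\frac{2(1-\beta)}{L_g}$ is read as $s>0$ and $sL_g<2(1-\beta)$ (so when $L_g=0$ any $s>0$ is allowed). Łojasiewicz property: a differentiable function $f:\mathbb{R}^k\to\mathbb{R}$ fulfills the Łojasiewicz property at $\overline{z}\in\operatorname{crit} f$ with Łojasiewicz exponent $\theta\in(0,1)$ if there exist $K,\epsilon>0$ such that $|f(z)-f(\overline{z})|^\theta\le K\|\nabla f(z)\|$ for every $z$ with $\|z-\overline{z}\|<\epsilon$. (Applied to $H$ with $\mathbb{R}^m\times\mathbb{R}^m\cong\mathbb{R}^{2m}$.) *)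

(* Defs.v *)
From HB Require Import structures.
From mathcomp Require Import all_boot all_order all_algebra.
From mathcomp Require Import all_classical all_reals all_analysis.

Set Implicit Arguments.
Unset Strict Implicit.
Unset Printing Implicit Defensive.

Import Order.TTheory GRing.Theory Num.Theory.
Import numFieldNormedType.Exports.

Local Open Scope classical_set_scope.
Local Open Scope ring_scope.

(* The canonical norm [`|v|] on ['rV[R]_k] is the sup norm. It induces the
   topology and the Frechet differential used below, which depend only on the
   equivalence class of the norm; metric quantities use [enorm]. *)
Definition enorm (R : realType) (k : nat) (v : 'rV[R]_k) : R :=
  Num.sqrt (\sum_(i < k) v 0 i ^+ 2).

(* ['D_v f z] is a junk value where [f] is not derivable: [grad] and [crit] are
   meant for differentiable functions. *)
Definition grad (R : realType) (k : nat) (f : 'rV[R]_k -> R) (z : 'rV[R]_k) :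
    'rV[R]_k :=
  \row_(i < k) 'D_(delta_mx 0 i) f z.

Definition crit (R : realType) (k : nat) (f : 'rV[R]_k -> R) :
    set 'rV[R]_k :=
  [set z | grad f z = 0].

Definition Lojasiewicz (R : realType) (k : nat) (f : 'rV[R]_k -> R)
    (zbar : 'rV[R]_k) (theta : R) : Prop :=
  [/\ forall z, differentiable f z,
      crit f zbar,
      0 < theta < 1
    & exists K eps : R, [/\ 0 < K, 0 < eps
      & forall z, enorm (z - zbar) < eps ->
          `|f z - f zbar| `^ theta <= K * enorm (grad f z)]].

(* R^m x R^m is encoded as ['rV[R]_(m + m)], so that [enorm] and [grad] on the
   product are the Euclidean ones; the pair (x, y) is [row_mx x y]. *)
Definition regularized (R : realType) (m : nat) (g : 'rV[R]_m -> R)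
    (z : 'rV[R]_(m + m)) : R :=
  g (lsubmx z) + 2^-1 * enorm (lsubmx z - rsubmx z) ^+ 2.

(* Main.v *)
(* With d n = x n.+1 - x n and t n the inertial coefficient, the descent lemma
   along the iteration bounds s * (g (y n.+2) - g (y n.+1)) by a quadratic form in
   d n and d n.+1.  As t n tends to beta and s * Lg < 2 * (1 - beta), for some
   delta > 0 the energy
     e n = g (y n.+1) - g xbar + delta / s * |d n|^2
   eventually decreases by at least a multiple of |d n|^2 + |d n.+1|^2.  It is also
   the gap of H at (y n.+1, y n.+1 - sigma d n) with sigma^2 = 2 delta / s, a point
   where |grad H| is bounded by a multiple of |d n| + |d n.+1|.  The Lojasiewicz
   inequality with theta <= 1/2 then yields e n.+1 <= q * e n with q < 1, so e n,
   |d n| and the tails of the series of the d n decay geometrically, which is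
   faster than any power of n. *)
Require Import Defs.
From HB Require Import structures.
From mathcomp Require Import all_boot all_order all_algebra.
From mathcomp Require Import all_classical all_reals all_analysis.
From mathcomp Require Import ring lra.

Set Implicit Arguments.
Unset Strict Implicit.
Unset Printing Implicit Defensive.

Import Order.TTheory GRing.Theory Num.Theory.
Import numFieldNormedType.Exports.

Local Open Scope classical_set_scope.
Local Open Scope ring_scope.

(** * Euclidean inner product and norm on row vectors *)

Section Euclidean.
Variables (R : realType) (k : nat).
Implicit Types (u v w : 'rV[R]_k) (a : R).

(** Written as a matrix product, so that bilinearity comes from that of [*m]. *)
Definition dot u v : R := (u *m v^T) 0 0.

Lemma dotE u v : dot u v = \sum_i u 0 i * v 0 i.
Proof. by rewrite /dot mxE; apply: eq_bigr => i _; rewrite mxE. Qed.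

Lemma dotC u v : dot u v = dot v u.
Proof. by rewrite !dotE; apply: eq_bigr => i _; rewrite mulrC. Qed.

Lemma dotDl u v w : dot (u + v) w = dot u w + dot v w.
Proof. by rewrite /dot mulmxDl mxE. Qed.

Lemma dotDr u v w : dot w (u + v) = dot w u + dot w v.
Proof. by rewrite !(dotC w) dotDl. Qed.

Lemma dotZl a u v : dot (a *: u) v = a * dot u v.
Proof. by rewrite /dot -scalemxAl mxE. Qed.

Lemma dotZr a u v : dot u (a *: v) = a * dot u v.
Proof. by rewrite !(dotC u) dotZl. Qed.

Lemma dotNl u v : dot (- u) v = - dot u v.
Proof. by rewrite /dot mulNmx mxE. Qed.

Lemma dotNr u v : dot u (- v) = - dot u v.
Proof. by rewrite !(dotC u) dotNl. Qed.

Lemma dot0l v : dot 0 v = 0.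
Proof. by rewrite /dot mul0mx mxE. Qed.

Lemma dot_ge0 u : 0 <= dot u u.
Proof. by rewrite dotE sumr_ge0// => i _; rewrite -expr2 sqr_ge0. Qed.

Lemma dot_eq0 u : dot u u = 0 -> u = 0.
Proof.
rewrite dotE => /eqP; rewrite psumr_eq0 => [/allP u0|i _]; last first.
  by rewrite -expr2 sqr_ge0.
apply/rowP => i; rewrite mxE; have /implyP := u0 i (mem_index_enum i).
by rewrite mulf_eq0 orbb => /(_ isT)/eqP.
Qed.

Definition dotE2 := (dotDl, dotDr, dotNl, dotNr, dotZl, dotZr).

(** The squared length of <v,v> u - <u,v> v is <v,v> times the difference of the two sides; the
    factor <v,v> cancels unless v = 0. *)
Lemma CauchySchwarz_sqr u v : dot u v ^+ 2 <= dot u u * dot v v.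
Proof.
have [v0|v0] := eqVneq (dot v v) 0.
  by rewrite (dot_eq0 v0) dotC !dot0l expr0n mulr0.
have vp : 0 < dot v v by rewrite lt_neqAle eq_sym v0 dot_ge0.
have := dot_ge0 (dot v v *: u - dot u v *: v).
rewrite !dotE2 (dotC v u) => h; rewrite -subr_ge0 -(pmulr_rge0 _ vp).
by apply: le_trans h _; rewrite le_eqVlt; apply/orP; left; apply/eqP; ring.
Qed.

Lemma enormE u : enorm u = Num.sqrt (dot u u).
Proof.
by rewrite /enorm dotE; congr Num.sqrt; apply: eq_bigr => i _; rewrite expr2.
Qed.

Lemma enorm_sqr u : enorm u ^+ 2 = dot u u.
Proof. by rewrite enormE sqr_sqrtr ?dot_ge0. Qed.

Lemma enorm_ge0 u : 0 <= enorm u.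
Proof. exact: sqrtr_ge0. Qed.

Lemma dot_le u v : `|dot u v| <= enorm u * enorm v.
Proof.
rewrite -(ler_pXn2r (n := 2))// ?nnegrE ?mulr_ge0 ?enorm_ge0//.
by rewrite exprMn !enorm_sqr real_normK ?num_real// CauchySchwarz_sqr.
Qed.

Lemma enormZ a u : enorm (a *: u) = `|a| * enorm u.
Proof. by rewrite !enormE !dotE2 mulrA -expr2 sqrtrM ?sqr_ge0// sqrtr_sqr. Qed.

Lemma enormN u : enorm (- u) = enorm u.
Proof. by rewrite -scaleN1r enormZ normrN1 mul1r. Qed.

Lemma enorm0 : enorm (0 : 'rV[R]_k) = 0.
Proof. by rewrite -(scale0r 0) enormZ normr0 mul0r. Qed.

Lemma enormC u v : enorm (u - v) = enorm (v - u).
Proof. by rewrite -enormN opprB. Qed.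

Lemma enormD u v : enorm (u + v) <= enorm u + enorm v.
Proof.
rewrite -(ler_pXn2r (n := 2))// ?nnegrE ?addr_ge0 ?enorm_ge0//.
rewrite sqrrD !enorm_sqr !dotE2 (dotC v u).
have := le_trans (ler_norm _) (dot_le u v); lra.
Qed.

Lemma enormB u v : enorm (u - v) <= enorm u + enorm v.
Proof. by rewrite (le_trans (enormD _ _))// enormN. Qed.

Lemma dot_le_avg u v : `|dot u v| <= (dot u u + dot v v) / 2.
Proof.
apply: le_trans (dot_le u v) _; rewrite -!enorm_sqr.
have := sqr_ge0 (enorm u - enorm v); rewrite sqrrB; lra.
Qed.

(** Bridge from the topology of the library, that of the sup norm, to the Euclidean norm:
    coordinates and the square root are continuous. *)
Lemma cvg_enorm0 (T : Type) (F : set_system T) {FF : Filter F} (f : T -> 'rV[R]_k) :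
  f @ F --> (0 : 'rV[R]_k) -> (fun t => enorm (f t)) @ F --> (0 : R).
Proof.
move=> f0; have fi i : (fun t => f t 0 i ^+ 2) @ F --> (0 : R).
  have h : (fun t => f t 0 i) @ F --> (0 : R).
    have -> : (0 : R) = (0 : 'rV[R]_k) 0 i by rewrite mxE.
    exact: (cvg_comp _ _ f0 (@coord_continuous _ _ _ 0 i _)).
  by rewrite -[X in _ --> X](mulr0 (0 : R)); exact: cvgM.
have sum0 : (fun t => \sum_(i < k) f t 0 i ^+ 2) @ F --> (0 : R).
  rewrite [X in _ --> X](_ : 0 = \sum_(i < k) (0 : R)); last by rewrite big1.
  exact: (@cvg_big R (ordinal k) +%R 0 xpredT (@add_continuous R) _ _ _
    (fun i t => f t 0 i ^+ 2) (fun=> 0)).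
have := cvg_comp _ _ sum0 (@sqrt_continuous R 0).
by rewrite sqrtr0.
Qed.

End Euclidean.

(** * Gradients and the descent lemma *)

Section Gradient.
Variables (R : realType) (k : nat) (g : 'rV[R]_k -> R).
Hypothesis g_diff : forall z, differentiable g z.

Lemma deriv_dot_grad z w : 'D_w g z = dot (grad g z) w.
Proof.
rewrite deriveE// [in LHS](row_sum_delta w) linear_sum dotE.
by apply: eq_bigr => i _; rewrite linearZ /= mxE deriveE// mulrC.
Qed.

(** The difference quotient of the one-variable function is exactly that of [g] in the direction
    [w]. *)
Lemma is_derive_line (u w : 'rV[R]_k) (c : R) :
  is_derive c 1 (fun t : R => g (t *: w + u)) (dot (grad g (c *: w + u)) w).
Proof.
have E : (fun h : R => h^-1 *: (((fun t : R => g (t *: w + u)) \o shift c) (h *: 1)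
    - g (c *: w + u))) = (fun h : R => h^-1 *: ((g \o shift (c *: w + u)) (h *: w)
    - g (c *: w + u))).
  apply/funext => h /=; rewrite /shift /=; congr (_ *: (g _ - _)).
  by rewrite scalerDl addrA [h%:A]mulr1.
apply: DeriveDef; first by rewrite /derivable E; exact: diff_derivable.
by rewrite -deriv_dot_grad /derive E.
Qed.

(** The mean value theorem replaces the usual integral: the function [f] below subtracts the linear
    and quadratic terms from [g] on the segment. By Cauchy-Schwarz and the Lipschitz bound its
    derivative is nonpositive at the intermediate point, so [f 1 <= f 0]. *)
Lemma descent (L : R) (u v : 'rV[R]_k) :
  (forall u v, enorm (grad g u - grad g v) <= L * enorm (u - v)) ->
  g v <= g u + dot (grad g u) (v - u) + L / 2 * dot (v - u) (v - u).
Proof.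
move=> g_lip; set w := v - u.
pose f (t : R) := g (t *: w + u) - dot (grad g u) w * t - L / 2 * dot w w * t ^+ 2.
pose df (t : R) := dot (grad g (t *: w + u)) w - dot (grad g u) w - L * dot w w * t.
have f_df (t : R) : is_derive t 1 f (df t).
  have h := is_derive_line u w t.
  rewrite /f; apply: is_derive_eq; rewrite /df /GRing.scale /= !mulr1.
  by field.
have cf : {within `[0, 1], continuous f}.
  apply: continuous_subspaceT => t.
  by apply: differentiable_continuous; apply/derivable1_diffP.
have [c /[!in_itv]/= /andP[c0 _]] := MVT ltr01 (fun t _ => f_df t) cf.
have -> : f 1 = g v - dot (grad g u) w - L / 2 * dot w w.
  by rewrite /f scale1r subrK expr1n !mulr1.
have -> : f 0 = g u by rewrite /f scale0r add0r expr0n !mulr0 !subr0.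
suff : df c <= 0 by lra.
rewrite /df -dotNl -dotDl subr_le0 (le_trans (ler_norm _))//.
rewrite (le_trans (dot_le _ _))//; have := g_lip (c *: w + u) u.
rewrite addrK enormZ gtr0_norm// => /(ler_wpM2r (enorm_ge0 w)) /le_trans; apply.
by rewrite -enorm_sqr expr2 !mulrA -!mulrA (mulrC c) !mulrA.
Qed.

End Gradient.

(** * The regularized function H and its gradient *)

Section Regularized.
Variables (R : realType) (m : nat) (g : 'rV[R]_m -> R).
Hypothesis g_diff : forall z, differentiable g z.

Lemma regularizedE (a b : 'rV[R]_m) :
  regularized g (row_mx a b) = g a + 2^-1 * dot (a - b) (a - b).
Proof. by rewrite /regularized row_mxKl row_mxKr enorm_sqr. Qed.

(** For h != 0 the difference quotient equals that of [g] plus <a - b, u - v> + (h/2) |u - v|^2, and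
    the last term vanishes in the limit. *)
Lemma deriv_regularized (a b u v : 'rV[R]_m) :
  'D_(row_mx u v) (regularized g) (row_mx a b) =
  dot (grad g a) u + dot (a - b) (u - v).
Proof.
have ga : (fun h : R => h^-1 *: ((g \o shift a) (h *: u) - g a)) @ 0^'
    --> dot (grad g a) u.
  by rewrite -deriv_dot_grad//; exact: diff_derivable.
apply: cvg_lim => //.
have hid : (fun h : R => h) @ 0^' --> (0 : R) by exact: nbhs_dnbhs.
have h0 : (fun h : R => h / 2 * dot (u - v) (u - v)) @ 0^' --> (0 : R).
  have := cvgM (cvgM hid (cvg_cst (2^-1 : R))) (cvg_cst (dot (u - v) (u - v))).
  by rewrite !mul0r; apply.
have := cvgD (cvgD ga (cvg_cst (dot (a - b) (u - v)))) h0.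
rewrite addr0 => /(_ _ _ _ _); apply: cvg_trans; apply: near_eq_cvg.
near=> h; have h_neq0 : h != 0 by near: h; exact: nbhs_dnbhs_neq.
rewrite /= /shift /= scale_row_mx add_row_mx !regularizedE.
have -> : h *: u + a - (h *: v + b) = h *: (u - v) + (a - b).
  by rewrite scalerBr; apply/rowP => i; rewrite !mxE; ring.
move: (u - v) (a - b) => p q; rewrite !dotE2 (dotC p q) /GRing.scale /=.
by rewrite !fctE /=; field.
Unshelve. all: by end_near. Qed.

Lemma grad_regularized (a b : 'rV[R]_m) :
  grad (regularized g) (row_mx a b) = row_mx (grad g a + (a - b)) (b - a).
Proof.
have dotd (w : 'rV[R]_m) j : dot w (delta_mx 0 j) = w 0 j.
  rewrite dotE (bigD1 j)//= big1 ?addr0 ?mxE ?eqxx ?mulr1// => i ij.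
  by rewrite mxE eqxx (negbTE ij) mulr0.
apply/rowP => i; rewrite -(splitK i); case: (fintype.split i) => j /=.
  rewrite row_mxEl mxE (_ : delta_mx _ _ = row_mx (delta_mx 0 j) 0); last first.
    by rewrite -[LHS]hsubmxK; congr row_mx; apply/rowP => l;
       rewrite !mxE ?eq_lshift ?eq_rlshift.
  by rewrite deriv_regularized subr0 -dotDl dotd.
rewrite row_mxEr mxE (_ : delta_mx _ _ = row_mx 0 (delta_mx 0 j)); last first.
  by rewrite -[LHS]hsubmxK; congr row_mx; apply/rowP => l;
     rewrite !mxE ?eq_rshift ?eq_lrshift.
by rewrite deriv_regularized dotC dot0l add0r sub0r dotNr dotd !mxE opprB.
Qed.

Lemma dot_row_mx (a b c d : 'rV[R]_m) :
  dot (row_mx a b) (row_mx c d) = dot a c + dot b d.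
Proof. by rewrite /dot tr_row_mx mul_row_col mxE. Qed.

Lemma enorm_row_mx_le (a b : 'rV[R]_m) : enorm (row_mx a b) <= enorm a + enorm b.
Proof.
rewrite -(ler_pXn2r (n := 2))// ?nnegrE ?addr_ge0 ?enorm_ge0//.
rewrite sqrrD !enorm_sqr dot_row_mx.
by have := mulr_ge0 (enorm_ge0 a) (enorm_ge0 b); lra.
Qed.

Lemma enorm_grad_regularized (a b : 'rV[R]_m) :
  enorm (grad (regularized g) (row_mx a b)) <= enorm (grad g a) + 2 * enorm (a - b).
Proof.
rewrite grad_regularized (le_trans (enorm_row_mx_le _ _))//.
by have := enormD (grad g a) (a - b); rewrite (enormC b); lra.
Qed.

End Regularized.

(** * Geometric decay compared with powers of n *)

Section RealSequences.
Variable R : realType.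
Implicit Types (u : nat -> R) (q : R).

Lemma geometric_bound u q N :
  0 <= q -> (forall n, (N <= n)%N -> u n.+1 <= q * u n) ->
  forall n, u (N + n)%N <= q ^+ n * u N.
Proof.
move=> q0 uq; elim=> [|n IH]; first by rewrite addn0 expr0 mul1r.
rewrite addnS (le_trans (uq _ (leq_addr _ _)))// exprS -mulrA.
by rewrite ler_wpM2l.
Qed.

(* With rho = r^(1/p), n^p r^n = (n rho^n)^p and Bernoulli bounds n rho^n. *)
Lemma geometric_powR_bound (r p : R) : 0 < r < 1 -> 0 < p ->
  exists2 C : R, 0 < C & forall n : nat, r ^+ n <= C / n.+1%:R `^ p.
Proof.
move=> /andP[r0 r1] p0.
pose rho := r `^ p^-1.
have rho0 : 0 < rho by exact: powR_gt0.
have rho1 : rho < 1.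
  have := @gt0_ltr_powR R p^-1; rewrite invr_gt0 => /(_ p0 r 1).
  by rewrite powR1 !nnegrE ler01 ltW//; exact.
pose h := rho^-1 - 1.
have h0 : 0 < h by rewrite subr_gt0 invf_gt1.
have hE : rho * (1 + h) = 1 by rewrite /h addrC subrK divff// gt_eqF.
have bern n : n.+1%:R * h <= (1 + h) ^+ n.+1.
  elim: n.+1 => [|j IH]; first by rewrite mul0r expr0.
  rewrite exprS -natr1 mulrDl mul1r.
  have : 1 <= (1 + h) ^+ j by rewrite exprn_ege1// lerDl ltW.
  by nra.
exists ((rho * h) `^ -p); first by apply: powR_gt0; exact: mulr_gt0.
move=> n.
have n0 : 0 < n.+1%:R :> R by rewrite ltr0n.
have rh0 : 0 < rho * h by exact: mulr_gt0.
have rhn0 : 0 < rho * h * n.+1%:R by exact: mulr_gt0.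
rewrite powRN -invfM -powRM ?ler0n ?(ltW rh0)//.
have -> : r ^+ n = (rho ^+ n) `^ p.
  rewrite -(powR_mulrn _ (ltW r0)) -(powR_mulrn n (ltW rho0)) -!powRrM.
  by rewrite mulrCA mulVf ?mulr1// gt_eqF.
rewrite -powRN -(mulN1r p) powRrM (powR_inv1 (ltW rhn0)).
rewrite ge0_ler_powR ?nnegrE ?invr_ge0 ?(ltW p0) ?(ltW rhn0) ?exprn_ge0 ?(ltW rho0)//.
rewrite -[leRHS]mul1r ler_pdivlMr//.
have := ler_wpM2l (exprn_ge0 n.+1 (ltW rho0)) (bern n).
by rewrite -exprMn hE expr1n exprSr; congr (_ <= _); ring.
Qed.

End RealSequences.

(** * From one-step estimates to rates of convergence *)

Section Rates.
Variable R : realType.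

Lemma polynomial_rate (f : nat -> R) (M r p : R) N :
  0 < r < 1 -> 0 < p -> (forall j, f (N + j.+1)%N <= M * r ^+ j) ->
  exists2 a : R, 0 < a & forall n : nat, (N < n)%N -> f n <= a * (1 / n%:R `^ p).
Proof.
move=> r01 p0 fM; have [C C0 rC] := geometric_powR_bound r01 p0.
have Np : 0 < N.+1%:R `^ p :> R by rewrite powR_gt0 ?ltr0n.
(* [M] may be zero or negative, so |M| + 1 keeps the constant positive. The last factor pays for the
   index shift, through N + j + 1 <= (N + 1)(j + 1). *)
exists ((`|M| + 1) * C * N.+1%:R `^ p); first by rewrite !mulr_gt0// ltr_wpDl.
move=> n Nn; have {Nn} [j ->] : exists j, n = (N + j.+1)%N.
  by exists (n - N.+1)%N; rewrite addnS -addSn subnKC.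
have np : 0 < (N + j.+1)%:R `^ p :> R by rewrite powR_gt0 ?ltr0n ?addnS.
have jp : 0 < j.+1%:R `^ p :> R by rewrite powR_gt0 ?ltr0n.
have njp : (N + j.+1)%:R `^ p <= N.+1%:R `^ p * j.+1%:R `^ p :> R.
  rewrite -powRM ?ler0n// ge0_ler_powR ?nnegrE ?mulr_ge0 ?ler0n ?(ltW p0)//.
  by rewrite -natrM ler_nat mulSn addnC leq_add2l leq_pmulr.
apply: le_trans (fM j) _.
have M1 : M <= `|M| + 1 by rewrite (le_trans (ler_norm _))// lerDl.
have rj : 0 <= r ^+ j by rewrite exprn_ge0//; case/andP: r01 => /ltW.
apply: le_trans (ler_wpM2r rj M1) _.
rewrite -!mulrA ler_wpM2l ?addr_ge0//; apply: le_trans (rC j) _.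
rewrite ler_pM2l// mul1r -[leLHS]mul1r ler_pdivrMr//.
by rewrite mulrAC ler_pdivlMr// mul1r.
Qed.

(** The increments from n to n + j are bounded by a partial geometric sum; then j is taken so large
    that x (n + j) is within an arbitrary e of the limit. *)
Lemma enorm_tail_le m (x : nat -> 'rV[R]_m) (xbar : 'rV[R]_m) (M r : R) :
  0 < r < 1 -> (forall n, enorm (x n.+1 - x n) <= M * r ^+ n) ->
  x @ \oo --> xbar -> forall n, enorm (x n - xbar) <= M / (1 - r) * r ^+ n.
Proof.
move=> /andP[r0 r1] xM xc n.
have d0 : 0 < 1 - r by rewrite subr_gt0.
have M0 : 0 <= M by have := le_trans (enorm_ge0 _) (xM 0%N); rewrite expr0 mulr1.
have step j : enorm (x n - x (n + j)%N) <= M / (1 - r) * (r ^+ n - r ^+ (n + j)).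
  elim: j => [|j IH]; first by rewrite addn0 !subrr enorm0 mulr0.
  have -> : x n - x (n + j.+1)%N = (x n - x (n + j)%N) - (x (n + j).+1 - x (n + j)%N).
    by rewrite addnS opprB addrA subrK.
  apply: le_trans (enormB _ _) _; apply: le_trans (lerD IH (xM _)) _.
  by rewrite addnS exprS le_eqVlt; apply/orP; left; apply/eqP; field; rewrite gt_eqF.
apply/ler_addgt0Pr => e e0.
have /(cvg_enorm0 (F := \oo)) x0 : (fun n => x n - xbar) @ \oo --> (0 : 'rV[R]_m).
  by rewrite -(subrr xbar); apply: cvgB => //; exact: cvg_cst.
have [N _ xN] := cvgr_lt _ x0 _ e0.
have /ltW xe := xN (n + N)%N (leq_addl _ _).
rewrite -(subrK (x (n + N)%N) (x n)) -addrA.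
apply: le_trans (enormD _ _) _; apply: lerD xe; apply: le_trans (step N) _.
by rewrite ler_wpM2l ?divr_ge0 ?(ltW d0)// gerBl exprn_ge0// ltW.
Qed.

(** Serves to show that the energy, which tends to 0, is nonnegative once it decreases. *)
Lemma eventually_ge_cvg (e : nat -> R) (l : R) N :
  (forall n, (N <= n)%N -> e n.+1 <= e n) -> e @ \oo --> l ->
  forall n, (N <= n)%N -> l <= e n.
Proof.
move=> edec ecvg n Nn.
have mono j : e (n + j)%N <= e n.
  elim: j => [|j IH]; first by rewrite addn0.
  by rewrite addnS (le_trans _ IH)// edec// (leq_trans Nn)// leq_addr.
apply: (cvgr_to_le ecvg); exists n => // k /= nk.
by rewrite -(subnKC nk).
Qed.

(** The coefficient is beta - beta alpha / (n + 1 + alpha), and the fraction is squeezed by the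
    harmonic sequence. *)
Lemma inertial_coef_cvg (beta alpha : R) : 0 < alpha ->
  (fun n : nat => beta * n.+1%:R / (n.+1%:R + alpha)) @ \oo --> beta.
Proof.
move=> alpha_gt0.
have nz (n : nat) : 0 < n.+1%:R + alpha by rewrite addr_gt0// ltr0n.
have h : (fun n => beta - beta * alpha * (n.+1%:R + alpha)^-1) @ \oo
    --> beta - beta * alpha * 0.
  apply: cvgB; first exact: cvg_cst.
  apply: cvgM; first exact: cvg_cst.
  apply: (@squeeze_cvgr _ _ _ _ (fun=> 0) (@harmonic R)).
  - near=> n; rewrite invr_ge0 (ltW (nz n)) lef_pV2 ?posrE ?ltr0n//.
    by rewrite lerDl ltW.
  - exact: cvg_cst.
  - exact: cvg_harmonic.
rewrite mulr0 subr0 in h; apply: cvg_trans h; apply: near_eq_cvg.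
near=> n; move: (nz n); move: (n.+1%:R) => k k0.
by field; rewrite gt_eqF.
Unshelve. all: by end_near. Qed.

(** Since e <= 1 and 2 theta <= 1, e <= e^(2 theta) <= 2 C^2 (a^2 + b^2) <= W (e - e'). Adding e' <=
    e to this gives (W + 1) e' <= W e, with a ratio that lies in (0, 1) for every W > 0. *)
Lemma Lojasiewicz_contraction (theta C D : R) :
  theta <= 2^-1 -> 0 < C -> 0 < D ->
  exists2 q : R, 0 < q < 1 & forall e e' a b : R, 0 <= e <= 1 ->
    e `^ theta <= C * (a + b) -> D * (a ^+ 2 + b ^+ 2) <= e - e' -> e' <= q * e.
Proof.
move=> theta_le C0 D0; pose W := 2 * C ^+ 2 / D.
have W0 : 0 < W by rewrite divr_gt0// mulr_gt0// exprn_gt0.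
have W1 : 0 < W + 1 by rewrite ltr_wpDr.
exists (W / (W + 1)); first by rewrite divr_gt0//= ltr_pdivrMr// mul1r ltrDl.
move=> e e' a b /andP[e0 e1] loj dec.
have dec0 : 0 <= e - e'.
  by apply: le_trans dec; rewrite mulr_ge0 ?(ltW D0)// addr_ge0 ?sqr_ge0.
suff : e <= W * (e - e').
  by move=> h; rewrite mulrAC ler_pdivlMr//; lra.
have e_sqr : e <= (e `^ theta) ^+ 2.
  have [->|en0] := eqVneq e 0; first exact: sqr_ge0.
  have {}en0 : 0 < e by rewrite lt_neqAle eq_sym en0.
  rewrite -powR_mulrn ?powR_ge0// -powRrM -{1}(powRr1 e0).
  by rewrite ger_powR ?en0//; lra.
have Cab0 := le_trans (powR_ge0 _ _) loj.
apply: le_trans e_sqr _; apply: (@le_trans _ _ ((C * (a + b)) ^+ 2)).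
  by rewrite ler_pXn2r ?nnegrE ?powR_ge0 ?Cab0.
have -> : W * (e - e') = C ^+ 2 * (2 * ((e - e') / D)).
  by rewrite /W; field; rewrite gt_eqF.
rewrite exprMn ler_wpM2l ?sqr_ge0//.
have : a ^+ 2 + b ^+ 2 <= (e - e') / D by rewrite ler_pdivlMr// mulrC.
by have := sqr_ge0 (a - b); lra.
Qed.

End Rates.

(** * Decrease of the energy along the iteration *)

Section Energy.
Variable R : realType.

(* The quadratic form in (A, B, C) = (|d'|^2, |d|^2, <d, d'>) has limit
   coefficients a, b, c with c > 0 and a + b + c = kappa - (1 - beta) < 0, so
   delta = (b - a) / 2 balances the two diagonal terms. *)
Lemma energy_coef (t : nat -> R) (beta kappa : R) :
  0 < beta < 1 -> kappa < 1 - beta -> t @ \oo --> beta ->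
  exists delta D : R, [/\ 0 < delta, 0 < D & \forall n \near \oo, forall A B C : R,
    0 <= A -> 0 <= B -> `|C| <= (A + B) / 2 ->
    t n * (2 + t n.+1) * C - t n ^+ 2 * B - (1 + t n.+1) * A
    + kappa * ((1 + t n.+1) ^+ 2 * A - 2 * t n * (1 + t n.+1) * C + t n ^+ 2 * B)
    + delta * (A - B) <= - D * (A + B)].
Proof.
move=> /andP[b0 b1] kb tb.
have tb' : (fun n => t n.+1) @ \oo --> beta by rewrite cvg_shiftS.
pose c := beta * (2 + beta) - kappa * (2 * beta * (1 + beta)).
pose a := kappa * (1 + beta) ^+ 2 - (1 + beta).
pose b := (kappa - 1) * beta ^+ 2.
have t1 : (fun n => 1 + t n.+1) @ \oo --> 1 + beta.
  by apply: cvgD => //; exact: cvg_cst.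
pose cn n := t n * (2 + t n.+1) - kappa * (2 * t n * (1 + t n.+1)).
pose an n := kappa * (1 + t n.+1) ^+ 2 - (1 + t n.+1).
pose bn n := (kappa - 1) * t n ^+ 2.
have cc : cn @ \oo --> c.
  apply: cvgB; first by apply: cvgM => //; apply: cvgD => //; exact: cvg_cst.
  apply: cvgM; first exact: cvg_cst.
  by apply: cvgM => //; apply: cvgM => //; exact: cvg_cst.
have ca : an @ \oo --> a.
  apply: cvgB => //; apply: cvgM; first exact: cvg_cst.
  by rewrite expr2; under eq_fun do rewrite expr2; exact: cvgM.
have cb : bn @ \oo --> b.
  apply: cvgM; first exact: cvg_cst.
  by rewrite expr2; under eq_fun do rewrite expr2; exact: cvgM.
(* Replacing [kappa] by its bound 1 - beta leaves c >= beta^2 + 2 beta^3. *)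
have c0 : 0 < c.
  have h : kappa * (beta * (1 + beta)) <= (1 - beta) * (beta * (1 + beta)).
    by rewrite ler_wpM2r ?ltW// mulr_gt0// addr_gt0.
  have h2 := exprn_gt0 2 b0; have h3 := exprn_gt0 3 b0.
  rewrite /c; nra.
pose delta := (b - a) / 2; pose D := (1 - beta - kappa) / 4.
have abc : a + b + c = - (4 * D) by rewrite /a /b /c /D; field.
have D0 : 0 < D by rewrite divr_gt0// subr_gt0.
(* The same replacement gives b - a >= beta^2. *)
have delta0 : 0 < delta.
  rewrite divr_gt0//.
  have h : kappa * (1 + 2 * beta) <= (1 - beta) * (1 + 2 * beta).
    by rewrite ler_wpM2r ?ltW// addr_gt0// mulr_gt0.
  by have h2 := exprn_gt0 2 b0; rewrite /b /a; nra.
exists delta, D; split => //.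
have cnorm : (fun n => `|cn n|) @ \oo --> c.
  by rewrite -[X in _ --> X](gtr0_norm c0); exact: cvg_norm.
have l1 : (fun n => an n + `|cn n| * 2^-1) @ \oo --> a + c / 2.
  by apply: cvgD => //; apply: cvgM => //; exact: cvg_cst.
have l2 : (fun n => bn n + `|cn n| * 2^-1) @ \oo --> b + c / 2.
  by apply: cvgD => //; apply: cvgM => //; exact: cvg_cst.
(* Half of the cross term goes to each square. By the choice of [delta], a + c/2 + delta and b + c/2
   - delta both equal (a + b + c)/2 = -2D, which leaves a margin D for the passage to finite n. *)
have h1 : a + c / 2 < - D - delta by rewrite /delta; lra.
have h2 : b + c / 2 < - D + delta by rewrite /delta; lra.
near=> n => A B C A0 B0 CAB.
have e1 : an n + `|cn n| * 2^-1 <= - D - delta by near: n; exact: cvgr_le l1 _ h1.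
have e2 : bn n + `|cn n| * 2^-1 <= - D + delta by near: n; exact: cvgr_le l2 _ h2.
have e3 : cn n * C <= `|cn n| * ((A + B) / 2).
  by rewrite (le_trans (ler_norm _))// normrM ler_wpM2l.
have e1A := ler_wpM2r A0 e1; have e2B := ler_wpM2r B0 e2.
have -> : t n * (2 + t n.+1) * C - t n ^+ 2 * B - (1 + t n.+1) * A
    + kappa * ((1 + t n.+1) ^+ 2 * A - 2 * t n * (1 + t n.+1) * C + t n ^+ 2 * B)
    = an n * A + bn n * B + cn n * C.
  by rewrite /an /bn /cn; ring.
move: (an n) (bn n) (cn n) (`|cn n|) e1A e2B e3 => *; lra.
Unshelve. all: by end_near. Qed.

(** The iteration gives s grad g(y) = t d - d' and y' - y = (1 + t') d' - t d; substituting both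
    into s times the descent lemma turns it into a form in d and d' alone. *)
Lemma energy_step m (g : 'rV[R]_m -> R) (L s t t' : R) (x d y d' y' : 'rV[R]_m) :
  (forall z, differentiable g z) ->
  (forall u v, enorm (grad g u - grad g v) <= L * enorm (u - v)) ->
  0 < s -> y = x + t *: d -> d' = y - s *: grad g y - x -> y' = x + d' + t' *: d' ->
  s * (g y' - g y) <= t * (2 + t') * dot d d' - t ^+ 2 * dot d d - (1 + t') * dot d' d'
    + s * L / 2 * ((1 + t') ^+ 2 * dot d' d' - 2 * t * (1 + t') * dot d d'
                   + t ^+ 2 * dot d d).
Proof.
move=> g_diff g_lip s0 yE d'E y'E.
have gE : s *: grad g y = t *: d - d'.
  by rewrite d'E {2}yE; apply/rowP => i; rewrite !mxE; ring.
have wE : y' - y = (1 + t') *: d' - t *: d.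
  by rewrite y'E yE; apply/rowP => i; rewrite !mxE; ring.
have := descent g_diff y y' g_lip; rewrite -(ler_pM2l s0) => h.
rewrite mulrBr lerBlDr; apply: le_trans h _; rewrite !mulrDr -(dotZl s (grad g y)).
rewrite gE wE !dotE2 (dotC d' d) le_eqVlt; apply/orP; left; apply/eqP.
by field.
Qed.

End Energy.

(** * Convergence rates of the iterates and of the function values *)

Theorem theorem11 (R : realType) (m : nat) (g : 'rV[R]_m -> R)
    (Lg alpha beta s theta : R) (x y : nat -> 'rV[R]_m) (xbar : 'rV[R]_m)
    (g_diff : forall z, differentiable g z)
    (Lg_ge0 : 0 <= Lg)
    (g_lip : forall u v, enorm (grad g u - grad g v) <= Lg * enorm (u - v))
    (g_lb : exists M : R, forall z, M <= g z)
    (alpha_gt0 : 0 < alpha)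
    (beta01 : 0 < beta < 1)
    (s_gt0 : 0 < s)
    (s_lt : s * Lg < 2 * (1 - beta))
    (xy0 : x 0%N = y 0%N)
    (xS : forall n, x n.+1 = y n - s *: grad g (y n))
    (yS : forall n, (0 < n)%N ->
      y n = x n + (beta * n%:R / (n%:R + alpha)) *: (x n - x n.-1))
    (x_bounded : exists M : R, forall n, enorm (x n) <= M)
    (xbar_crit : crit g xbar)
    (x_cvg : x @ \oo --> xbar)
    (theta_gt0 : 0 < theta)
    (theta_le : theta <= 2^-1)
    (H_loj : Lojasiewicz (regularized g) (row_mx xbar xbar) theta) :
  forall p : R, 0 < p ->
  exists (a1 a2 a3 a4 : R) (kbar : nat),
    [/\ 0 < a1, 0 < a2, 0 < a3 & 0 < a4] /\
    [/\ forall n : nat, (kbar < n)%N ->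
          g (y n) - g xbar <= a1 * (1 / n%:R `^ p),
        forall n : nat, (kbar < n)%N ->
          g (x n) - g xbar <= a2 * (1 / n%:R `^ p),
        forall n : nat, (kbar < n)%N ->
          enorm (x n - xbar) <= a3 * (1 / n%:R `^ (p / 2))
      & forall n : nat, (kbar < n)%N ->
          enorm (y n - xbar) <= a4 * (1 / n%:R `^ (p / 2))].
Proof.
move=> p p0.
have /andP[b0 b1] := beta01.
(* Shifted by one: [t n] is the coefficient that produces [y n.+1], so the rule for y, valid from
   index 1 on, applies for every n. *)
pose t n := beta * n.+1%:R / (n.+1%:R + alpha).
pose d n := x n.+1 - x n.
have nz n : 0 < n.+1%:R + alpha by rewrite addr_gt0// ltr0n.
have t0 n : 0 <= t n by rewrite divr_ge0 ?(ltW (nz n))// mulr_ge0 ?ler0n// ltW.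
have t1 n : t n <= 1.
  rewrite ler_pdivrMr// mul1r; have : 0 < n.+1%:R :> R by rewrite ltr0n.
  by nra.
have tb : t @ \oo --> beta by exact: inertial_coef_cvg.
have yE n : y n.+1 = x n.+1 + t n *: d n by rewrite yS.
have dE n : d n.+1 = y n.+1 - s *: grad g (y n.+1) - x n.+1 by rewrite /d xS.
have kap : s * Lg / 2 < 1 - beta by lra.
have [delta [D [de0 D0 hE]]] := energy_coef beta01 kap tb.
have xS_cvg : (fun n => x n.+1) @ \oo --> xbar by rewrite (@cvg_shiftS _ x).
have d_cvg : d @ \oo --> (0 : 'rV[R]_m) by rewrite -(subrr xbar); exact: cvgB.
have y_cvg : (fun n => y n.+1) @ \oo --> xbar.
  have -> : (fun n => y n.+1) = (fun n => x n.+1 + t n *: d n) by apply/funext.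
  by have := cvgD xS_cvg (cvgZ tb d_cvg); rewrite scaler0 addr0; apply.
have nd0 : (fun n => enorm (d n)) @ \oo --> (0 : R) by exact: cvg_enorm0.
have ny0 : (fun n => enorm (y n.+1 - xbar)) @ \oo --> (0 : R).
  by apply: cvg_enorm0; rewrite -(subrr xbar); apply: cvgB => //; exact: cvg_cst.
have gy_cvg : (fun n => g (y n.+1)) @ \oo --> g xbar.
  exact: (cvg_comp _ _ y_cvg (differentiable_continuous (g_diff xbar))).
pose e n := g (y n.+1) - g xbar + delta / s * dot (d n) (d n).
have e_cvg : e @ \oo --> (0 : R).
  have -> : e = (fun n => g (y n.+1) - g xbar + delta / s * (enorm (d n) * enorm (d n))).
    by apply/funext => n; rewrite -expr2 enorm_sqr.
  have := cvgD (cvgB gy_cvg (cvg_cst (g xbar)))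
    (cvgM (cvg_cst (delta / s)) (cvgM nd0 nd0)).
  by rewrite subrr !mulr0 addr0; apply.
pose sig := Num.sqrt (2 * (delta / s)).
have ds0 : 0 < delta / s by rewrite divr_gt0.
have sig0 : 0 <= sig by exact: sqrtr_ge0.
have sigE : 2^-1 * sig ^+ 2 = delta / s.
  by rewrite sqr_sqrtr ?mulr_ge0 ?(ltW de0) ?invr_ge0 ?(ltW s_gt0)// mulKf.
pose z n := row_mx (y n.+1) (y n.+1 - sig *: d n).
have zH n : regularized g (z n) - regularized g (row_mx xbar xbar) = e n.
  rewrite !regularizedE subrr dot0l mulr0 addr0 subKr dotZl dotZr (mulrA sig) -expr2.
  by rewrite mulrA sigE addrAC.
have nz0 : (fun n => 2 * enorm (y n.+1 - xbar) + sig * enorm (d n)) @ \oo --> (0 : R).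
  have := cvgD (cvgM (cvg_cst (2 : R)) ny0) (cvgM (cvg_cst sig) nd0).
  by rewrite !mulr0 addr0; apply.
have zle n : enorm (z n - row_mx xbar xbar)
    <= 2 * enorm (y n.+1 - xbar) + sig * enorm (d n).
  rewrite opp_row_mx add_row_mx (le_trans (enorm_row_mx_le _ _))//.
  rewrite -[sig](ger0_norm sig0) -enormZ ger0_norm//.
  have := enormB (y n.+1 - xbar) (sig *: d n).
  by rewrite addrAC; lra.
have [_ _ _ [K [eps [K0 eps0 loj]]]] := H_loj.
(* [N] is the largest of three thresholds: for the decrease of the energy, for e n <= 1, and for z n
   to lie in the Lojasiewicz ball. *)
have [N [e_dec e_le1 e_loj]] : exists N, [/\
    forall n, (N <= n)%N ->
      s * (e n.+1 - e n) <= - D * (dot (d n.+1) (d n.+1) + dot (d n) (d n)),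
    forall n, (N <= n)%N -> e n <= 1 &
    forall n, (N <= n)%N ->
      `|e n| `^ theta <= K * enorm (grad (regularized g) (z n))].
  have [N1 _ h1] := hE.
  have [N2 _ h2] := cvgr_le _ e_cvg _ (ltr01 : (0 : R) < 1).
  have [N3 _ h3] := cvgr_lt _ nz0 _ eps0.
  exists (maxn N1 (maxn N2 N3)); split=> n; rewrite !geq_max => /and3P[n1 n2 n3].
  - have := h1 n n1 (dot (d n.+1) (d n.+1)) (dot (d n) (d n)) (dot (d n) (d n.+1))
      (dot_ge0 _) (dot_ge0 _).
    rewrite addrC => /(_ (dot_le_avg _ _)).
    have x2 : x n.+2 = x n.+1 + d n.+1 by rewrite /d addrC subrK.
    have y2 : y n.+2 = x n.+1 + d n.+1 + t n.+1 *: d n.+1 by rewrite yE x2.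
    have := energy_step g_diff g_lip s_gt0 (yE n) (dE n) y2.
    have -> : s * (e n.+1 - e n) = s * (g (y n.+2) - g (y n.+1))
        + delta * (dot (d n.+1) (d n.+1) - dot (d n) (d n)).
      by rewrite /e; field; rewrite gt_eqF.
    rewrite (addrC (dot (d n) (d n))).
    move: (dot _ _) (dot _ _) (dot _ _) => *; lra.
  - exact: h2.
  - by rewrite -zH; apply: loj; apply: le_lt_trans (zle n) (h3 n n3).
have e_nincr n : (N <= n)%N -> e n.+1 <= e n.
  move=> /e_dec h; rewrite -subr_le0 -(pmulr_rle0 _ s_gt0) (le_trans h)//.
  by rewrite mulNr oppr_le0 mulr_ge0 ?(ltW D0)// addr_ge0 ?dot_ge0.
have e_ge0 := eventually_ge_cvg e_nincr e_cvg.
(* The first summand comes from s grad g(y) = t d - d' with t <= 1, the second from twice the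
   distance sigma |d| between the two components of z. *)
pose C1 := s^-1 + 2 * sig.
have gradH n : enorm (grad (regularized g) (z n))
    <= C1 * (enorm (d n) + enorm (d n.+1)).
  apply: le_trans (enorm_grad_regularized g_diff _ _) _.
  rewrite subKr enormZ (ger0_norm sig0).
  have -> : grad g (y n.+1) = s^-1 *: (t n *: d n - d n.+1).
    by rewrite dE yE; apply/rowP => i; rewrite !mxE; field; rewrite gt_eqF.
  have := enormB (t n *: d n) (d n.+1); rewrite enormZ (ger0_norm (t0 n)).
  have := ler_wpM2r (enorm_ge0 (d n)) (t1 n).
  rewrite enormZ gtr0_norm ?invr_gt0// mul1r => h1 h2.
  have h3 := le_trans h2 (lerD h1 (lexx _)).
  have si0 : 0 <= s^-1 by rewrite invr_ge0 ltW.
  have := ler_wpM2l si0 h3; rewrite /C1.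
  have := mulr_ge0 sig0 (enorm_ge0 (d n.+1)); lra.
have C10 : 0 < C1 by rewrite ltr_wpDr ?mulr_ge0// invr_gt0.
have [q q01 contr] := Lojasiewicz_contraction theta_le (mulr_gt0 K0 C10)
  (divr_gt0 D0 s_gt0).
have eq_step n : (N <= n)%N -> e n.+1 <= q * e n.
  move=> Nn; have en0 := e_ge0 n Nn.
  apply: (contr _ _ (enorm (d n)) (enorm (d n.+1))).
  - by rewrite en0 e_le1.
  - rewrite -{1}(ger0_norm en0) (le_trans (e_loj n Nn))// -mulrA.
    by rewrite ler_wpM2l ?(ltW K0).
  - rewrite !enorm_sqr mulrAC ler_pdivrMr//.
    by have := e_dec n Nn; lra.
have [q0 q1] := andP q01.
have e_geo := geometric_bound (ltW q0) eq_step.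
(* The energy controls |d|^2, so norms decay with ratio sqrt q. *)
pose r := Num.sqrt q.
have r2 : r ^+ 2 = q by rewrite sqr_sqrtr ?(ltW q0).
have r0 : 0 < r by rewrite sqrtr_gt0.
have r01 : 0 < r < 1.
  by rewrite r0 -(ltr_pXn2r (n := 2))// ?nnegrE ?ltW// r2 expr1n.
(* From D |d n|^2 <= s (e n - e n.+1) <= s e n and the geometric decay of e after N. *)
pose M := Num.sqrt (s / D * e N).
have eN := e_ge0 N (leqnn N).
have dM j : enorm (d (N + j)%N) <= M * r ^+ j.
  rewrite -(ler_pXn2r (n := 2))// ?nnegrE ?enorm_ge0 ?mulr_ge0 ?exprn_ge0 ?sqrtr_ge0//.
  rewrite enorm_sqr exprMn sqr_sqrtr ?mulr_ge0 ?invr_ge0 ?(ltW s_gt0) ?(ltW D0)//.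
  rewrite exprAC r2 -!mulrA mulrCA ler_pdivlMl//.
  have Nj := leq_addr j N.
  have := e_dec _ Nj; have := e_ge0 _ (leqW Nj).
  have := e_geo j; have := dot_ge0 (d (N + j).+1).
  move=> h1 h2 h3 h4.
  have h5 := ler_wpM2l (ltW s_gt0) h2; have h6 := mulr_ge0 (ltW s_gt0) h3.
  have h7 := mulr_ge0 (ltW D0) h1.
  by rewrite (mulrC (e N)); lra.
pose M1 := M / (1 - r).
have xM j : enorm (x (N + j)%N - xbar) <= M1 * r ^+ j.
  apply: (enorm_tail_le (x := fun j => x (N + j)%N)) => //.
    by move=> n; rewrite addnS; exact: dM.
  have -> : (fun j => x (N + j)%N) = [sequence x (n + N)%N]_n.
    by apply/funext => i; rewrite addnC.
  by rewrite cvg_shiftn.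
have M10 : 0 <= M1.
  by have := le_trans (enorm_ge0 _) (xM 0%N); rewrite expr0 mulr1.
have M0 : 0 <= M by exact: sqrtr_ge0.
(* Weaker than [xM], but of the same form as the bound for y, so that both sequences can be fed to
   [g_rate]. *)
have x_rate j : enorm (x (N + j.+1)%N - xbar) <= (M1 + M) * r ^+ j.
  apply: le_trans (xM _) _; rewrite exprS.
  have rj := exprn_ge0 j (ltW r0); have := andP r01 => -[_ r1].
  have h1 := mulr_ge0 M10 rj; have h2 := mulr_ge0 M0 rj.
  have := ler_wpM2r h1 (ltW r1); lra.
have y_rate j : enorm (y (N + j.+1)%N - xbar) <= (M1 + M) * r ^+ j.
  have -> : y (N + j.+1)%N - xbar = (x (N + j.+1)%N - xbar) + t (N + j)%N *: d (N + j)%N.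
    by rewrite addnS yE addrAC.
  apply: le_trans (enormD _ _) _; rewrite enormZ ger0_norm//.
  have h := xM j.+1; have := ler_wpM2r (enorm_ge0 (d (N + j)%N)) (t1 (N + j)%N).
  have := dM j; move: h; rewrite exprS mul1r.
  have rj := exprn_ge0 j (ltW r0); have := andP r01 => -[_ r1].
  have h1 := mulr_ge0 M10 rj.
  have := ler_wpM2r h1 (ltW r1); lra.
(* The gradient vanishes at [xbar], so the descent lemma has no linear term there; function values
   inherit the squared ratio r^2 = q. *)
have g_le v : g v - g xbar <= Lg / 2 * enorm (v - xbar) ^+ 2.
  have := descent g_diff xbar v g_lip.
  by rewrite (xbar_crit : grad g xbar = 0) dot0l addr0 enorm_sqr; lra.
have g_rate (w : nat -> 'rV[R]_m) :
    (forall j, enorm (w (N + j.+1)%N - xbar) <= (M1 + M) * r ^+ j) ->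
    forall j, g (w (N + j.+1)%N) - g xbar <= (Lg / 2 * (M1 + M) ^+ 2) * q ^+ j.
  move=> wM j; apply: le_trans (g_le _) _; rewrite -(mulrA (Lg / 2)).
  rewrite ler_wpM2l ?divr_ge0//.
  rewrite -r2 exprAC -exprMn ler_pXn2r ?nnegrE ?enorm_ge0//.
  exact: le_trans (enorm_ge0 _) (wM j).
have p20 : 0 < p / 2 by rewrite divr_gt0.
have [a1 ? ha1] :=
  polynomial_rate (f := fun n => g (y n) - g xbar) q01 p0 (g_rate y y_rate).
have [a2 ? ha2] :=
  polynomial_rate (f := fun n => g (x n) - g xbar) q01 p0 (g_rate x x_rate).
have [a3 ? ha3] :=
  polynomial_rate (f := fun n => enorm (x n - xbar)) r01 p20 x_rate.
have [a4 ? ha4] :=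
  polynomial_rate (f := fun n => enorm (y n - xbar)) r01 p20 y_rate.
by exists a1, a2, a3, a4, N.
Qed.
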